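(* Let $p\ge 5$ be a prime and $n$ a positive integer. Then \[ C_{np}^{*}\equiv C_n^{*}+p^2\left(\frac{p}{3}\right)B_{p-2}\!\left(\tfrac{1}{3}\right)\mathcal{C}_n^{*}\pmod{p^3}, \qquad\text{where}\quad \mathcal{C}_n^{*}=\frac{1}{2}\sum_{k=0}^{n-1}\binom{n}{k}^2\binom{2k}{k}(n-k)^2 . \]
   Context: For $n\in\mathbb{N}$, $C^{*}_n=\sum_{k=0}^n\binom{n}{k}^2\binom{2k}{k}$. The Bernoulli polynomials $B_m(x)$ are defined by $\frac{ze^{xz}}{e^z-1}=\sum_{m\ge0}B_m(x)\frac{z^m}{m!}$. $\left(\frac{p}{3}\right)$ is the Legendre symbol. For rationals $a,b$, $a\equiv b\pmod{p^m}$ means $(a-b)/p^m$ is a rational number whose denominator is not divisible by $p$. *)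

(* Defs.v *)
From mathcomp Require Import all_boot all_order all_algebra.
Set Implicit Arguments. Unset Strict Implicit. Unset Printing Implicit Defensive.
Import Order.TTheory GRing.Theory Num.Theory.
Local Open Scope ring_scope.

Definition Cstar (n : nat) : nat :=
  (\sum_(k < n.+1) 'C(n, k) ^ 2 * 'C(k.*2, k))%N.

Definition Cscr (n : nat) : rat :=
  2%:R^-1 * \sum_(k < n) (('C(n, k) ^ 2 * 'C(k.*2, k) * (n - k) ^ 2)%N)%:R.

(* Bernoulli numbers B_0..B_n (B_1 = -1/2), via the recurrence
   sum_{k=0}^{m} C(m+1,k) B_k = 0 (m >= 1), which is equivalent to
   z/(e^z-1) = sum B_m z^m/m!. *)
Fixpoint bernl (n : nat) : seq rat :=
  match n with
  | 0 => [:: 1]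
  | n'.+1 => let s := bernl n' in
      rcons s (- (n'.+2%:R)^-1 * \sum_(k < n'.+1) 'C(n'.+2, k)%:R * nth 0 s k)
  end.

Definition bernoulli (n : nat) : rat := nth 0 (bernl n) n.

(* Bernoulli polynomial B_m(x) = sum_k C(m,k) B_k x^(m-k), the polynomial
   whose exponential generating function is z e^{xz}/(e^z-1). *)
Definition bernpoly (m : nat) (x : rat) : rat :=
  \sum_(k < m.+1) 'C(m, k)%:R * bernoulli k * x ^+ (m - k).

Definition legendre3 (p : nat) : rat :=
  if (p %% 3 == 1)%N then 1 else if (p %% 3 == 2)%N then -1 else 0.

Definition rat_congr (a b : rat) (p m : nat) : Prop :=
  ~~ ((p%:Z) %| denq ((a - b) / (p ^ m)%:R))%Z.

(* Main.v *)
(* Write k = pj + r in C*_(np).  The terms with r = 0 give C*_n mod p^3 by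
   Jacobsthal's congruence binom(pa,pb) = binom(a,b).  For r > 0, binom(np,k) is
   p n/r binom(n-1,j) binom(p-1,r-1) mod p^2, so these terms contribute p^2 times
   2 Cscr_n times S = sum_(0<r<p) binom(2r,r)/r^2 mod p.
   As binom(2r,r) = (-4)^r binom((p-1)/2,r) mod p, differentiating twice in x gives
   sum_r binom(2r,r) (x(1-x))^r/r^2 = 2 (L(x) + L(1-x)) with L(x) = sum_r x^r/r^2;
   at x(1-x) = 1, a sixth root of unity, this expresses S by a 6-periodic character
   sum, and the symmetries r -> p-r and r -> 2r turn it into sum_(0<s<p/3) 1/s^2.
   Since 1/s^2 = s^(p-3) mod p, this is a value of B_(p-2) at an integer congruent
   to 1/3 or 2/3, and B_(p-2)(1-x) = -B_(p-2)(x). *)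

Require Import Defs.
From mathcomp Require Import all_boot all_order all_algebra.
From mathcomp Require Import finfield.
From mathcomp Require Import ring zify.
Set Implicit Arguments. Unset Strict Implicit. Unset Printing Implicit Defensive.
Import Order.TTheory GRing.Theory Num.Theory.
Local Open Scope ring_scope.

(** * Congruences for binomial coefficients modulo a prime *)

Lemma natFp_eq0 p n : prime p -> (n%:R == 0 :> 'F_p) = (p %| n)%N.
Proof. by move=> pr_p; rewrite (dvdn_pcharf (pchar_Fp pr_p)). Qed.

Lemma natFp_neq0 p n : prime p -> (0 < n < p)%N -> n%:R != 0 :> 'F_p.
Proof. by move=> pr_p /andP[n_gt0 ltnp]; rewrite natFp_eq0 // gtnNdvd. Qed.

Lemma intFp_eq0 p (z : int) : prime p -> (z%:~R == 0 :> 'F_p) = (p %| z)%Z.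
Proof. by move=> pr_p; rewrite (dvdz_pcharf (pchar_Fp pr_p)). Qed.

Lemma coef_X1_exp (R : comNzRingType) n k : (('X + 1 : {poly R}) ^+ n)`_k = 'C(n, k)%:R.
Proof.
rewrite exprDn coef_sum.
under eq_bigr => i _ do rewrite expr1n mulr1 coefMn coefXn.
have [lekn|ltnk] := leqP k n.
  rewrite (bigD1 (rev_ord (Ordinal (lekn : (k < n.+1)%N)))) //= subSS subKn // eqxx.
  rewrite bin_sub // big1 ?addr0 // => i ne_i.
  case: eqP => [kE|_]; last by rewrite mul0rn.
  case/eqP: ne_i; apply: val_inj => /=.
  have := ltn_ord i; lia.
rewrite bin_small // big1 // => i _.
by case: eqP => [kE|_]; [lia|rewrite mul0rn].
Qed.

Lemma exprD_poly_Fp p (a b : {poly 'F_p}) : prime p -> (a + b) ^+ p = a ^+ p + b ^+ p.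
Proof.
move=> pr_p; apply: exprDn_pchar.
by rewrite pnatE // (pchar_lalg {poly 'F_p}) pchar_Fp.
Qed.

(** Lucas' congruence: mod p, (X + 1)^(p+N) = (X^p + 1)(X + 1)^N yields a Pascal rule of step p,
    which drives the induction on [a]. *)
Lemma lucas_Fp p a b c d : prime p -> (b < p)%N -> (d < p)%N ->
  'C(a * p + b, c * p + d)%:R = 'C(a, c)%:R * 'C(b, d)%:R :> 'F_p.
Proof.
move=> pr_p ltbp ltdp.
have step N K : 'C(p + N, K)%:R = 'C(N, K)%:R + (if (K < p)%N then 0 else 'C(N, K - p)%:R) :> 'F_p.
  rewrite -!coef_X1_exp exprD exprD_poly_Fp // expr1n mulrDl mul1r addrC coefD.
  by rewrite coefXnM.
elim: a c => [|a IHa] c.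
  case: c => [|c]; first by rewrite !mul0n !add0n mul1r.
  by rewrite mul0r bin_small //; nia.
rewrite mulSn -addnA step IHa; case: c => [|c].
  by rewrite mul0n add0n ltdp addr0 !bin0.
rewrite ifN; last by rewrite -leqNgt; nia.
have -> : (c.+1 * p + d - p = c * p + d)%N by nia.
by rewrite IHa binS natrD mulrDl addrC.
Qed.

(** * Jacobsthal's congruence *)

Lemma Fp_expn_pred p (x : 'F_p) : prime p -> x != 0 -> x ^+ p.-1 = 1.
Proof.
move=> pr_p x_neq0; apply: (mulfI x_neq0); rewrite mulr1 -exprS prednK ?prime_gt0 //.
by rewrite -{2}[x]expf_card card_Fp.
Qed.

Lemma fact_addn m n : ((m + n)`! = m`! * \prod_(i < n) (m + i.+1))%N.
Proof.
elim: n => [|n IHn]; first by rewrite addn0 big_ord0 muln1.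
by rewrite addnS factS IHn big_ord_recr /= addnS mulnC mulnA.
Qed.

Lemma fact_mulp p a : (0 < p)%N ->
  ((p * a)`! = p ^ a * a`! * \prod_(j < a) \prod_(i < p.-1) (p * j + i.+1))%N.
Proof.
case: p => // p _; elim: a => [|a IHa]; first by rewrite muln0 big_ord0.
rewrite mulnSr fact_addn IHa big_ord_recr [in RHS]big_ord_recr /= expnS factS.
move: (\prod_(_ < a) _)%N (\prod_(_ < p) _)%N => A B; ring.
Qed.

Lemma natFp_inj p i j : prime p -> (i%:R = j%:R :> 'F_p) -> (i < p)%N -> (j < p)%N -> i = j.
Proof.
by move=> pr_p /(congr1 val) /=; rewrite !val_Fp_nat // => + ltip ltjp; rewrite !modn_small.
Qed.

(** Its value at pj is the product of the integers strictly between pj and p(j+1), the factors prime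
    to p in a factorial. *)
Definition shiftpoly (p : nat) : {poly int} := \prod_(i < p.-1) ('X + (i.+1%:R)%:P).

Lemma shiftpoly_nat p x : (shiftpoly p).[x%:R] = (\prod_(i < p.-1) (x + i.+1))%N%:R.
Proof.
rewrite /shiftpoly horner_prod natr_prod; apply: eq_bigr => i _.
by rewrite hornerD hornerX hornerC natrD.
Qed.

(** Reversing the order of the factors, -p + i = -(p - i), and the p - 1 signs cancel because p - 1
    is even. *)
Lemma shiftpoly_opp p : odd p -> (shiftpoly p).[- p%:R] = (shiftpoly p).[0].
Proof.
case: p => // p /= even_p; rewrite /shiftpoly !horner_prod /=.
rewrite (reindex_inj rev_ord_inj) /=.
transitivity (\prod_(i < p) (- 1 : int) * \prod_(i < p) ('X + (i.+1%:R)%:P : {poly int}).[0]).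
  rewrite -big_split; apply: eq_bigr => i _ /=.
  rewrite !hornerD !hornerX !hornerC add0r subnSK // natrB; last exact: ltnW.
  by rewrite -natr1; ring.
by rewrite prodr_const card_ord -signr_odd (negPf even_p) mul1r.
Qed.

(** By Fermat, the p - 1 nonzero residues are the roots of X^(p-1) - 1. *)
Lemma shiftpoly_Fp p : prime p -> map_poly intr (shiftpoly p) = 'X^(p.-1) - 1 :> {poly 'F_p}.
Proof.
move=> pr_p; have p1_gt0 : (0 < p.-1)%N by case: (p) pr_p => [|[]].
pose rs : seq 'F_p := [seq - (i.+1%:R) | i : 'I_p.-1].
have size_rs : size rs = p.-1 by rewrite size_map -cardE card_ord.
have rs_neq0 : {in rs, forall x, x != 0}.
  move=> x /mapP[i _ ->]; rewrite oppr_eq0 natFp_neq0 //=.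
  by have := ltn_ord i; lia.
rewrite (@all_roots_prod_XsubC _ ('X^(p.-1) - 1) rs).
- rewrite lead_coefXnsubC // scale1r big_map big_enum /= rmorph_prod.
  apply: eq_bigr => i _.
  by rewrite rmorphD /= map_polyX map_polyC /= rmorph_nat polyCN opprK.
- by rewrite size_XnsubC // size_rs.
- by apply/allP => x /rs_neq0 x0; rewrite rootE !hornerE Fp_expn_pred // subrr.
rewrite uniq_rootsE map_inj_uniq ?enum_uniq // => i j /oppr_inj/(natFp_inj pr_p) eqij.
by apply/val_inj/succn_inj/eqij; [have := ltn_ord i|have := ltn_ord j]; lia.
Qed.

(* Since f(X) = (X+1)...(X+p-1) satisfies f(-p) = f(0) and f = X^(p-1) - 1 mod p,
   its linear coefficient is divisible by p^2 (Wolstenholme). *)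
Lemma shiftpoly_mod p j : prime p -> (5 <= p)%N ->
  exists z, (shiftpoly p).[(p * j)%:R] = (shiftpoly p).[0] + z * p%:R ^+ 3.
Proof.
move=> pr_p p_ge5; set G := shiftpoly p.
have GE y : G.[y] = G.[0] + y * (G`_1 + y * (G`_2 + y * (drop_poly 3 G).[y])).
  rewrite horner_coef0 -{1}(poly_take_drop 3 G) hornerD hornerM hornerXn.
  rewrite (horner_coef_wide _ (size_take_poly 3 G)) !big_ord_recl big_ord0.
  rewrite !coef_take_poly /= /bump /=; ring.
have coefG k : (0 < k < 3)%N -> exists z, G`_k = z * p%:R.
  move=> k_bnd; rewrite natz; apply/dvdzP; rewrite -(intFp_eq0 _ pr_p) -coef_map /= shiftpoly_Fp //.
  by rewrite coefB coefXn coef1 ltn_eqF ?gtn_eqF ?subrr //; lia.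
have [z2 G2] := coefG 2 isT; have p_neq0 : p%:R != 0 :> int by lia.
have odd_p : odd p by case: (even_prime pr_p) => // p2; rewrite p2 in p_ge5.
have /eqP := shiftpoly_opp odd_p.
(* Cancelling the factor -p in f(-p) = f(0) gives G_1 = p G_2 - p^2 d(-p), where d =
   [drop_poly 3 G]; this is divisible by p^2 since p divides G_2. *)
rewrite -/G GE -subr_eq0 addrC addKr mulf_eq0 oppr_eq0 (negPf p_neq0) /= addr_eq0 => /eqP G1.
rewrite GE G1 G2 natrM.
set d := drop_poly 3 G; set y := p%:R * j%:R.
exists (j%:R * (z2 - d.[- p%:R] + j%:R * (z2 + j%:R * d.[y]))); rewrite /y; ring.
Qed.

Lemma Zp_nat_inj q m n : (1 < q)%N -> m%:R = n%:R :> 'Z_q -> m = n %[mod q].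
Proof. by move=> q_gt1 /(congr1 val) /=; rewrite !val_Zp_nat. Qed.

Lemma prod_shift_Zp p j : prime p -> (5 <= p)%N ->
  (\prod_(i < p.-1) (p * j + i.+1))%:R = p.-1`!%:R :> 'Z_(p ^ 3).
Proof.
move=> pr_p p_ge5; have [z] := shiftpoly_mod j pr_p p_ge5.
have p3_gt1 : (1 < p ^ 3)%N by rewrite (ltn_exp2l 0) ?prime_gt1.
rewrite -[0]/(0%:R) !shiftpoly_nat => /(congr1 (intr : int -> 'Z_(p ^ 3))).
rewrite rmorphD rmorphM rmorphXn /= !rmorph_nat -natrX pchar_Zp // mulr0 addr0 => ->.
by congr _%:R; rewrite -[p.-1 in RHS]add0n fact_addn mul1n.
Qed.

(** Once the multiples of p are taken out of the factorials, blocks of p - 1 consecutive integers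
    remain, each congruent to (p-1)! mod p^3, with [a] blocks in numerator and denominator alike. *)
Lemma jacobsthal p a b : prime p -> (5 <= p)%N -> (b <= a)%N ->
  'C(p * a, p * b) = 'C(a, b) %[mod p ^ 3].
Proof.
move=> pr_p p_ge5 leba; have p_gt0 := prime_gt0 pr_p.
have p3_gt1 : (1 < p ^ 3)%N by rewrite (ltn_exp2l 0) ?prime_gt1.
set Q := fun c => (\prod_(j < c) \prod_(i < p.-1) (p * j + i.+1))%N.
have QE c : (Q c)%:R = p.-1`!%:R ^+ c :> 'Z_(p ^ 3).
  rewrite /Q natr_prod; under eq_bigr => j _ do rewrite prod_shift_Zp //.
  by rewrite prodr_const card_ord.
have eqQ : ('C(p * a, p * b) * (Q b * Q (a - b)) = 'C(a, b) * Q a)%N.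
  have := bin_fact (leq_mul (leqnn p) leba); rewrite -mulnBr !fact_mulp //.
  rewrite -/(Q a) -/(Q b) -/(Q (a - b)%N) -(bin_fact leba) => eqf.
  have pE : (p ^ a = p ^ b * p ^ (a - b))%N by rewrite -expnD subnKC.
  apply/eqP; rewrite -(@eqn_pmul2l (p ^ b * p ^ (a - b) * (b`! * (a - b)`!))%N).
    by apply/eqP; transitivity ('C(p * a, p * b) * (p ^ b * b`! * Q b *
         (p ^ (a - b) * (a - b)`! * Q (a - b))))%N; [|rewrite eqf pE]; ring.
  by rewrite !muln_gt0 !expn_gt0 !fact_gt0 p_gt0.
apply: Zp_nat_inj => //; apply: (@mulIr _ (p.-1`!%:R ^+ a)).
  (* By Wilson, (p-1)! is prime to p, so the blocks can be cancelled mod p^3. *)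
  rewrite unitrX // unitZpE // coprimeXl //.
  rewrite prime_coprime //; apply/negP => dvd_fact.
  by have := Wilson (prime_gt1 pr_p); rewrite pr_p -addn1 dvdn_addr // dvdn1 gtn_eqF ?prime_gt1.
have uE : p.-1`!%:R ^+ a = (Q b * Q (a - b))%N%:R :> 'Z_(p ^ 3).
  by rewrite natrM !QE -exprD subnKC.
by rewrite [in LHS]uE -QE -!natrM eqQ.
Qed.

(** * Central binomial polylogarithms *)

Lemma half_Fp p : prime p -> odd p -> (p./2)%:R * 2%:R = - 1 :> 'F_p.
Proof.
move=> pr_p odd_p; apply/eqP; rewrite -addr_eq0 -natrM natr1 natFp_eq0 // muln2.
by rewrite -add1n -[1%N]/(nat_of_bool true) -odd_p odd_double_half.
Qed.

Lemma mulS_bin_central r : (r.+1 * 'C(r.+1.*2, r.+1) = 2 * r.*2.+1 * 'C(r.*2, r))%N.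
Proof.
have := mul_bin_diag r.+1.*2 r; have := mul_bin_down r.*2.+1 r; rewrite doubleS /=.
have -> : (r.*2.+1 - r = r.+1)%N by lia.
by move=> e1 <-; rewrite -doubleS -mul2n -!mulnA e1.
Qed.

(** Over the rationals binom(2r,r) = (-4)^r binom(-1/2,r), and [p./2] is -1/2 mod p; the induction
    compares ratios of consecutive terms. *)
Lemma bin_central_Fp p r : prime p -> odd p -> (r < p)%N ->
  'C(r.*2, r)%:R = (- 4%:R) ^+ r * 'C(p./2, r)%:R :> 'F_p.
Proof.
move=> pr_p odd_p; elim: r => [|r IHr] ltrp; first by rewrite !bin0 mul1r.
have r1_neq0 : r.+1%:R != 0 :> 'F_p by rewrite natFp_neq0.
have m_half := half_Fp pr_p odd_p.
apply: (mulfI r1_neq0); rewrite -natrM mulS_bin_central natrM IHr; last exact: ltnW.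
have eq_left : r.+1%:R * 'C(p./2, r.+1)%:R = (p./2 - r)%:R * 'C(p./2, r)%:R :> 'F_p.
  by rewrite -!natrM mul_bin_left.
rewrite exprS [RHS]mulrCA eq_left.
(* Past [p./2] the subtraction [p./2 - r] truncates, but there ['C(p./2, r)] is 0. *)
have [lerm|ltmr] := leqP r p./2; last by rewrite bin_small // !mulr0.
rewrite natrB // natrM -muln2 -(addn1 (r * 2)) natrD natrM.
move: (p./2)%:R m_half => m m_half.
transitivity ((- 2%:R * (m * 2%:R) + 4%:R * r%:R) * ((- 4%:R) ^+ r * 'C(p./2, r)%:R)); last by ring.
by rewrite m_half; ring.
Qed.

(** In characteristic p, differentiation kills only the monomials of degree divisible by p; below
    degree p that is the constant alone. *)
Lemma poly_deriv_eq0 p (P : {poly 'F_p}) : prime p ->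
  (size P <= p)%N -> P^`() = 0 -> P.[0] = 0 -> P = 0.
Proof.
move=> pr_p sizeP dP0 P0; apply/polyP => -[|i]; first by rewrite coef0 -horner_coef0.
have [lepi|ltip] := leqP p i.+1; first by rewrite coef0 nth_default // (leq_trans sizeP).
move/(congr1 (fun Q : {poly 'F_p} => Q`_i)): dP0.
rewrite coef_deriv coef0 -mulr_natr => /eqP; rewrite mulf_eq0.
by rewrite (negPf (@natFp_neq0 p i.+1 pr_p ltip)) orbF coef0 => /eqP.
Qed.

Lemma deriv_sumXn (R : nzRingType) n (a : nat -> R) :
  (\sum_(r < n) a r *: 'X^r)^`() * 'X = \sum_(r < n) (a r * r%:R) *: 'X^r.
Proof.
rewrite linear_sum mulr_suml; apply: eq_bigr => -[[|r] /= ltrp] _.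
  by rewrite derivZ derivC scaler0 mul0r mulr0 scale0r.
by rewrite derivZ derivXn -scalerAl mulrnAl -exprSr -scaler_nat scalerA.
Qed.

Lemma odd_prime_ge5 p : prime p -> (5 <= p)%N -> odd p.
Proof. by move=> /even_prime[-> //|]. Qed.

Section CentralBinomialPolylog.
Variables (p : nat).
Hypotheses (pr_p : prime p) (p_ge5 : (5 <= p)%N).

Let odd_p : odd p := odd_prime_ge5 pr_p p_ge5.

Local Notation F := 'F_p.
Local Notation t := ('X * (1 - 'X) : {poly F}).

(* As 0^-1 = 0, the term r = 0 vanishes for d > 0, here and in all sums of 1/r^d below. *)
Definition finite_polylog d : {poly F} := \sum_(r < p) r%:R ^- d *: 'X^r.

Definition central_polylog d : {poly F} :=
  \sum_(r < p) ('C(r.*2, r)%:R / r%:R ^+ d) *: 'X^r.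

Lemma two_neq0 : 2%:R != 0 :> F.
Proof. by rewrite natFp_neq0 // (leq_trans _ p_ge5). Qed.

Lemma expfV_mul (x : F) d : x ^- d.+2 * x = x ^- d.+1.
Proof.
have [->|x0] := eqVneq x 0; first by rewrite mulr0 expr0n invr0.
by rewrite [x ^+ d.+2]exprS invfM mulrAC mulVf ?mul1r.
Qed.

Lemma deriv_finite_polylog d : (finite_polylog d.+2)^`() * 'X = finite_polylog d.+1.
Proof.
by rewrite (deriv_sumXn _ (fun r => r%:R ^- d.+2)); apply: eq_bigr => r _; rewrite expfV_mul.
Qed.

Lemma deriv_central_polylog d : (central_polylog d.+2)^`() * 'X = central_polylog d.+1.
Proof.
rewrite (deriv_sumXn _ (fun r => 'C(r.*2, r)%:R / r%:R ^+ d.+2)).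
by apply: eq_bigr => r _; rewrite -mulrA expfV_mul.
Qed.

(** The quotient r/r is 1 except at r = 0, where it is 0; hence the correction by the constant
    term. *)
Lemma sum_divff (a : nat -> F) : \sum_(r < p) (a r * (r%:R / r%:R)) *: 'X^r =
  \sum_(r < p) a r *: 'X^r - (a 0)%:P.
Proof.
have p_gt0 := prime_gt0 pr_p; pose z := Ordinal p_gt0.
rewrite (bigD1 z) //= [in RHS](bigD1 z) //= mul0r mulr0 scale0r add0r expr0 alg_polyC addrAC subrr add0r.
apply: eq_bigr => r ne_r0; rewrite divff ?mulr1 // natFp_neq0 // ltn_ord andbT lt0n.
by apply: contraNneq ne_r0 => r0; apply/eqP/val_inj.
Qed.

Lemma deriv_finite_polylog1 : (finite_polylog 1)^`() * t = 'X - 'X^p.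
Proof.
rewrite mulrA (deriv_sumXn _ (fun r => r%:R ^- 1)).
under eq_bigr => r _ do rewrite expr1 mulrC -[_ / _]mul1r.
rewrite (sum_divff (fun=> 1)); under eq_bigr => r _ do rewrite scale1r.
have := subrX1 ('X : {poly F}) p; set s := \sum_(i < p) _ => sE.
suff: s * (1 - 'X) = 1 - 'X^p by move=> e; rewrite mulrBl e mul1r; ring.
by rewrite -opprB mulrN mulrC -sE opprB.
Qed.

(** By [bin_central_Fp], the generating polynomial of the central binomials is the binomial
    expansion of (1 - 4X)^((p-1)/2). *)
Lemma deriv_central_polylog1 : (central_polylog 1)^`() * 'X = (1 - 4%:R *: 'X) ^+ p./2 - 1.
Proof.
rewrite (deriv_sumXn _ (fun r => 'C(r.*2, r)%:R / r%:R ^+ 1)).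
under eq_bigr => r _ do rewrite expr1 -mulrA [_^-1 * _]mulrC.
rewrite (sum_divff (fun r => 'C(r.*2, r)%:R)) bin0; congr (_ - _).
rewrite exprDn (big_ord_widen p (fun r => 1 ^+ (p./2 - r) * (- (4%:R *: 'X)) ^+ r *+ 'C(p./2, r))).
  rewrite [RHS]big_mkcond; apply: eq_bigr => r _ /=; rewrite bin_central_Fp // //.
  case: ltnP => [_|ltmr]; last by rewrite bin_small // mulr0 scale0r.
  by rewrite expr1n mul1r -scaleNr exprZn mulrC -scalerA scaler_nat.
by have := p_ge5; lia.
Qed.

Lemma size_central_polylog d : (size (central_polylog d) <= p./2.+1)%N.
Proof.
apply/leq_sizeP => i ltmi; rewrite coef_sum big1 // => r _; rewrite coefZ coefXn.
case: eqP => [ir|_]; last by rewrite mulr0.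
by rewrite bin_central_Fp // bin_small ?mulr0 ?mul0r // -ir.
Qed.

Lemma size_t : size t = 3%N.
Proof.
rewrite size_mul ?polyX_eq0 -?size_poly_eq0 -?[1 - 'X]opprB ?size_polyN ?size_XsubC //.
by rewrite size_polyX.
Qed.

(** Central binomials past [p./2] vanish mod p, so substituting the quadratic [t] keeps the degree
    below p, as [poly_deriv_eq0] requires. *)
Lemma size_comp_central d : (size (central_polylog d \Po t) <= p)%N.
Proof.
apply: leq_trans (size_comp_poly_leq _ _) _; rewrite size_t /=.
have := size_central_polylog d; have := odd_double_half p; rewrite odd_p.
by move: (size _) => s; lia.
Qed.

Lemma size_finite_polylog d : (size (finite_polylog d) <= p)%N.
Proof.
apply/leq_sizeP => i lepi; rewrite coef_sum big1 // => r _; rewrite coefZ coefXn.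
by rewrite gtn_eqF ?mulr0 // (leq_trans _ lepi).
Qed.

Lemma finite_polylog0 d : (finite_polylog d.+1).[0] = 0.
Proof.
rewrite /finite_polylog horner_sum big1 // => -[[|r] ltrp] _ /=; rewrite hornerZ hornerXn.
  by rewrite expr0n invr0 mul0r.
by rewrite expr0n mulr0.
Qed.

Lemma central_polylog0 d : (central_polylog d.+1).[0] = 0.
Proof.
rewrite /central_polylog horner_sum big1 // => -[[|r] ltrp] _ /=; rewrite hornerZ hornerXn.
  by rewrite expr0n invr0 mulr0 mul0r.
by rewrite expr0n mulr0.
Qed.

Lemma deriv_t : t^`() = 1 - 'X *+ 2.
Proof. by rewrite derivM derivB derivX derivC; ring. Qed.

Lemma comp_t (P : {poly F}) : (P * 'X) \Po t = (P \Po t) * t.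
Proof. by rewrite comp_polyM comp_polyX. Qed.

Lemma t_neq0 : t != 0.
Proof. by rewrite -size_poly_eq0 size_t. Qed.

(** Derivatives agree: 1 - 4t = (1 - 2X)^2 and t' = 1 - 2X, so (1 - 4t)^((p-1)/2) t' = (1 - 2X)^p =
    1 - 2X^p by Frobenius. *)
Lemma central_polylog1 : central_polylog 1 \Po t = finite_polylog 1 *+ 2.
Proof.
apply/eqP; rewrite -subr_eq0; apply/eqP/(poly_deriv_eq0 pr_p).
- rewrite (leq_trans (size_polyD _ _)) // geq_max size_comp_central size_polyN.
  by rewrite -scaler_nat (leq_trans (size_scale_leq _ _)) // size_finite_polylog.
- apply: (mulIf t_neq0); rewrite derivB derivMn mulrBl mulrnAl deriv_finite_polylog1 mul0r.
  rewrite deriv_comp mulrAC -comp_t deriv_central_polylog1 deriv_t.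
  rewrite comp_polyB rmorphXn /= comp_polyB comp_polyZ comp_polyX !comp_polyC.
  have -> : 1 - 4%:R *: t = (1 - 'X *+ 2) ^+ 2 by rewrite scaler_nat; ring.
  rewrite -exprM mulrBl mul1r -exprSr.
  have -> : (2 * p./2).+1 = p by have := odd_double_half p; rewrite odd_p; lia.
  rewrite exprD_poly_Fp // expr1n -scaler_nat -scaleNr exprZn.
  have -> : (- 2%:R) ^+ p = - 2%:R :> F by rewrite -[RHS]expf_card card_Fp.
  by rewrite !scaleNr !scaler_nat; ring.
by rewrite hornerD hornerN hornerMn finite_polylog0 horner_comp !hornerE central_polylog0 mul0rn subr0.
Qed.

Lemma mul2_inj (P Q : {poly F}) : P *+ 2 = Q *+ 2 -> P = Q.
Proof. by rewrite -!scaler_nat => /(scalerI two_neq0). Qed.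

(** By [central_polylog1] it is a function of [t], which is invariant under X -> 1 - X. *)
Lemma finite_polylog1_reflect : finite_polylog 1 \Po (1 - 'X) = finite_polylog 1.
Proof.
apply: mul2_inj; rewrite -[RHS]central_polylog1 -raddfMn -central_polylog1 /= -comp_polyA.
by congr (_ \Po _); rewrite comp_polyM comp_polyB comp_polyX comp_polyC; ring.
Qed.

Lemma sum_Fp (f : F -> F) : \sum_(r < p) f r%:R = \sum_(x : F) f x.
Proof.
rewrite [RHS](reindex (fun r : 'I_p => r%:R)) //; apply/onW_bij/inj_card_bij.
  by move=> i j /(natFp_inj pr_p) ij; apply/val_inj/ij.
by rewrite card_Fp // card_ord.
Qed.

(* The sum is invariant under x -> 2x, which divides it by 4. *)
Lemma sum_inv_squares : \sum_(r < p) r%:R ^- 2 = 0 :> F.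
Proof.
rewrite (sum_Fp (fun x => x ^- 2)); set s := \sum_(x : F) _.
have sE : s = 2%:R ^- 2 * s.
  rewrite /s mulr_sumr (reindex_inj (mulfI two_neq0)) /=.
  by apply: eq_bigr => x _; rewrite exprMn invfM.
have {}sE : 4%:R * s = s by rewrite {1}sE mulrA -natrX mulfV ?mul1r // natFp_neq0.
have /eqP : 3%:R * s = 0 by rewrite -[RHS](subrr s) -{2}sE; ring.
by rewrite mulf_eq0 (negPf (natFp_neq0 pr_p _)) /= ?(leq_trans _ p_ge5) // => /eqP.
Qed.

(** Differentiation reduces this to [central_polylog1] and the reflection of [finite_polylog 1]; the
    values at 0 agree because [finite_polylog 2] vanishes at 1 by [sum_inv_squares]. *)
Lemma central_polylog2 :
  central_polylog 2 \Po t = (finite_polylog 2 + (finite_polylog 2 \Po (1 - 'X))) *+ 2.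
Proof.
have size_1X : size (1 - 'X : {poly F}) = 2%N by rewrite -opprB size_polyN size_XsubC.
apply/eqP; rewrite -subr_eq0; apply/eqP/(poly_deriv_eq0 pr_p).
- rewrite (leq_trans (size_polyD _ _)) // geq_max size_comp_central size_polyN.
  rewrite -scaler_nat (leq_trans (size_scale_leq _ _)) // (leq_trans (size_polyD _ _)) //.
  by rewrite geq_max size_comp_poly2 // size_finite_polylog.
- apply: (mulIf t_neq0); rewrite derivB derivMn derivD mul0r mulrBl mulrnAl mulrDl.
  rewrite !deriv_comp mulrAC -comp_t deriv_central_polylog deriv_t central_polylog1.
  have -> : (finite_polylog 2)^`() * t = finite_polylog 1 * (1 - 'X).
    by rewrite mulrA deriv_finite_polylog.
  have -> : ((finite_polylog 2)^`() \Po (1 - 'X)) * (1 - 'X)^`() * t = - (finite_polylog 1 * 'X).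
    rewrite -finite_polylog1_reflect -[finite_polylog 1]deriv_finite_polylog.
    by rewrite comp_polyM comp_polyX derivB derivC derivX; ring.
  ring.
rewrite hornerD hornerN hornerMn hornerD !horner_comp finite_polylog0 !hornerE central_polylog0.
rewrite subr0 /finite_polylog horner_sum.
under eq_bigr => r _ do rewrite hornerZ hornerXn expr1n mulr1.
by rewrite sum_inv_squares mul0rn subr0.
Qed.

(** These write the power sums x^n + (1-x)^n in terms of t = x(1-x). Evaluating them at 1 replaces
    taking x to be a primitive sixth root of unity, which [F] may lack. *)
Fixpoint lucas_poly (n : nat) : {poly F} :=
  match n with
  | 0 => 2%:R%:P
  | n'.+1 => if n' is n''.+1 then lucas_poly n' - 'X * lucas_poly n'' else 1
  end.

Lemma comp_lucas_poly n : lucas_poly n \Po t = 'X^n + (1 - 'X) ^+ n.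
Proof.
elim/ltn_ind: n => -[|[|n]] IHn.
- by rewrite /= comp_polyC rmorph_nat !expr0.
- by rewrite /= rmorph1 !expr1 addrC subrK.
rewrite -[lucas_poly _]/(lucas_poly n.+1 - 'X * lucas_poly n) comp_polyB comp_polyM comp_polyX.
by rewrite !IHn // !exprS; ring.
Qed.

Lemma lucas_poly_at1 n : (lucas_poly n).[1] = (- 1) ^+ n * (if (3 %| n)%N then 2%:R else - 1).
Proof.
have rec k : (lucas_poly k.+2).[1] = (lucas_poly k.+1).[1] - (lucas_poly k).[1].
  by rewrite -[lucas_poly _]/(lucas_poly k.+1 - 'X * lucas_poly k) hornerD hornerN hornerM hornerX mul1r.
elim/ltn_ind: n => -[|[|[|n]]] IHn.
- by rewrite /= hornerC mul1r.
- by rewrite /= hornerC expr1 mulrN1 opprK.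
- by rewrite rec /= !hornerC /=; ring.
(* At 1, two uses of the recurrence give v(n+3) = -v(n). *)
have -> : (3 %| n.+3)%N = (3 %| n)%N by rewrite -(addn3 n) dvdn_addl.
rewrite !rec addrAC subrr sub0r IHn; last by rewrite ltnS ltnW.
by rewrite !exprS; ring.
Qed.

Lemma sum_central_lucas :
  \sum_(r < p) 'C(r.*2, r)%:R / r%:R ^+ 2 = 2%:R * \sum_(r < p) (lucas_poly r).[1] / r%:R ^+ 2.
Proof.
have eqt : central_polylog 2 = (\sum_(r < p) r%:R ^- 2 *: lucas_poly r) *+ 2.
  (* Composition with the nonconstant [t] is injective, so the identity may be checked after
     substitution. *)
  apply/eqP; rewrite -subr_eq0 -(@comp_poly_eq0 _ _ t) ?size_t // comp_polyB raddfMn /= subr_eq0.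
  rewrite central_polylog2; apply/eqP; congr (_ *+ 2).
  rewrite !linear_sum -big_split /=; apply: eq_bigr => r _.
  by rewrite !comp_polyZ comp_lucas_poly scalerDr rmorphXn /= comp_polyX.
transitivity (central_polylog 2).[1].
  by rewrite horner_sum; apply: eq_bigr => r _; rewrite hornerZ hornerXn expr1n mulr1.
rewrite eqt hornerMn horner_sum mulr_natl; congr (_ *+ 2).
by apply: eq_bigr => r _; rewrite hornerZ mulrC.
Qed.

End CentralBinomialPolylog.

(** * Sums of inverse squares *)

Lemma big_multiples (V : nmodType) (f : nat -> V) d n : (0 < d)%N ->
  \sum_(r < n.+1 | (d %| r)%N) f r = \sum_(s < (n %/ d).+1) f (d * s)%N.
Proof.
move=> d_gt0; elim: n => [|n IHn].
  by rewrite div0n big_mkcond !big_ord1 /= dvdn0 muln0.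
rewrite big_mkcond big_ord_recr -big_mkcond /= IHn divnS //.
case: ifP => [dvd_d|_]; last by rewrite addr0.
rewrite add1n [RHS]big_ord_recr /=; congr (_ + f _).
by have := divnS n d_gt0; rewrite dvd_d add1n => <-; rewrite mulnC divnK.
Qed.

Section InverseSquares.
Variables (p : nat).
Hypotheses (pr_p : prime p) (p_ge5 : (5 <= p)%N).

Let odd_p : odd p := odd_prime_ge5 pr_p p_ge5.

Local Notation F := 'F_p.
Local Notation h := (fun r : nat => r%:R ^- 2 : F).

(** The range includes r = p, whose term is 0 in [F], so that it is stable under r -> p - r. *)
Definition sum_inv2 (P : pred nat) : F := \sum_(r < p.+1 | P r) h r.

Lemma sum_inv2_rev P : sum_inv2 P = sum_inv2 (fun r => P (p - r)%N).
Proof.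
rewrite /sum_inv2 (reindex_inj rev_ord_inj) /=.
under eq_bigl => r do rewrite subSS.
apply: eq_bigr => r _; have lerp : (r <= p)%N by rewrite -ltnS.
by rewrite subSS natrB // pchar_Fp_0 // sub0r sqrrN.
Qed.

Lemma eq_sum_inv2 P Q : (forall r, (r <= p)%N -> P r = Q r) -> sum_inv2 P = sum_inv2 Q.
Proof. by move=> eqPQ; apply: eq_bigl => r; rewrite eqPQ // -ltnS. Qed.

Lemma sum_inv2_split P Q : sum_inv2 P = sum_inv2 [pred r | P r && Q r] + sum_inv2 [pred r | P r && ~~ Q r].
Proof. by rewrite /sum_inv2 (bigID (fun r : 'I_p.+1 => Q r)). Qed.

Lemma sum_inv2_half P Q :
  (forall r, (r <= p)%N -> P (p - r)%N = P r) -> (forall r, (r <= p)%N -> Q (p - r)%N = ~~ Q r) ->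
  sum_inv2 P = 2%:R * sum_inv2 [pred r | P r && Q r].
Proof.
move=> revP revQ; rewrite (sum_inv2_split P Q) mulr_natl mulr2n; congr (_ + _).
by rewrite sum_inv2_rev; apply: eq_sum_inv2 => r lerp /=; rewrite revP // revQ // negbK.
Qed.

Lemma sum_inv2_dvd (P : pred nat) d : (0 < d)%N ->
  sum_inv2 [pred r | (d %| r)%N && P r] = d%:R ^- 2 * \sum_(s < (p %/ d).+1 | P (d * s)%N) h s.
Proof.
move=> d_gt0; rewrite /sum_inv2 /= big_mkcondr (big_multiples (fun r => if P r then h r else 0)) //.
rewrite big_distrr [RHS]big_mkcond; apply: eq_bigr => s _ /=.
by rewrite natrM exprMn invfM.
Qed.

Lemma sum_inv2_all : sum_inv2 predT = 0.
Proof.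
by rewrite /sum_inv2 big_ord_recr /= pchar_Fp_0 // expr0n invr0 addr0 sum_inv_squares.
Qed.

(* Sorting by parity and residue mod 3, let a, b, c be the sums of 1/r^2 over even
   r <= p congruent to 0, p, 2p mod 3.  Then a + b + c = 0, and c = 4b because the
   class of 2p is stable under r -> p - r, so that the evens and the r <= p/2 each
   carry half of it, while r -> 2r maps its r <= p/2 onto the evens congruent to p. *)
Lemma sum_central_harmonic :
  \sum_(r < p) 'C(r.*2, r)%:R / r%:R ^+ 2 = \sum_(s < (p %/ 3).+1) h s.
Proof.
set a := sum_inv2 [pred r | (3 %| r)%N && (2 %| r)%N].
set b := sum_inv2 [pred r | (2 %| r)%N && (r == p %[mod 3])].
set c := sum_inv2 [pred r | (r == 2 * p %[mod 3]) && (2 %| r)%N].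
have p_mod3 : (p %% 3 != 0)%N.
  by rewrite -/(3 %| p)%N dvdn_prime2 //; apply: contraTneq p_ge5 => <-.
have two0 := two_neq0 pr_p p_ge5.
have even_rev r : (r <= p)%N -> (2 %| p - r)%N = ~~ (2 %| r)%N.
  by move=> lerp; rewrite !dvdn2 oddB // odd_p; case: (odd r).
have even0 : sum_inv2 (dvdn 2) = 0.
  have := sum_inv2_half (fun _ _ => erefl : predT _ = predT _) even_rev.
  rewrite sum_inv2_all => /esym/eqP; rewrite mulf_eq0 (negPf two0) /= => /eqP <-.
  exact: eq_sum_inv2.
(* As p is odd, r -> p - r sends the evens congruent to p mod 3 to the odd multiples of 3. *)
have b_rev : b = sum_inv2 [pred r | (3 %| r)%N && ~~ (2 %| r)%N].
  rewrite /b sum_inv2_rev; apply: eq_sum_inv2 => r lerp /=; rewrite even_rev // andbC.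
  by congr (_ && _); move: p_mod3; lia.
have abc : a + b + c = 0.
  rewrite -even0 (sum_inv2_split _ (dvdn 3)) -addrA; congr (_ + _).
    by apply: eq_sum_inv2 => r _ /=; rewrite andbC.
  rewrite (sum_inv2_split _ (fun r => r == p %[mod 3])); congr (_ + _).
    by apply: eq_sum_inv2 => r _ /=; rewrite -andbA; congr (_ && _); move: p_mod3; lia.
  apply: eq_sum_inv2 => r _ /=; rewrite andbC -andbA; congr (_ && _); move: p_mod3; lia.
have cb : c = 4%:R * b.
  have rev_c r : (r <= p)%N -> (p - r == 2 * p %[mod 3]) = (r == 2 * p %[mod 3]).
    by move: p_mod3; lia.
  have rev_half r : (r <= p)%N -> (p - r <= p %/ 2)%N = ~~ (r <= p %/ 2)%N.
    by move: odd_p; lia.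
  apply: (mulfI two0); rewrite -(sum_inv2_half rev_c even_rev) (sum_inv2_half rev_c rev_half).
  congr (_ * _); rewrite /b sum_inv2_dvd // mulrA -natrX divff ?mul1r; last first.
    by rewrite natFp_neq0 // (leq_trans _ p_ge5).
  have lt_half : ((p %/ 2).+1 <= p.+1)%N by lia.
  have /= -> := big_ord_widen_cond (op := +%R) (idx := 0) _ (fun s => 2 * s == p %[mod 3])%N h lt_half.
  by apply: eq_bigl => s /=; rewrite ltnS; congr (_ && _); move: p_mod3; lia.
have three0 : 3%:R != 0 :> F by rewrite natFp_neq0 // (leq_trans _ p_ge5).
(* The multiples of 3 up to p, even and odd, sum to a + b; dividing them by 3 gives the range s <=
   p/3 and the factor 9. *)
have nine : \sum_(s < (p %/ 3).+1) h s = 9%:R * (a + b).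
  rewrite b_rev -(sum_inv2_split (dvdn 3) (dvdn 2)).
  have -> : sum_inv2 (dvdn 3) = sum_inv2 [pred r | (3 %| r)%N && predT r].
    by apply: eq_sum_inv2 => r _ /=; rewrite andbT.
  by rewrite sum_inv2_dvd //= mulrA -natrX divff ?mul1r // (natrX F 3 2) expf_neq0.
(* The Lucas value at r is (-1)^r (3 [3 | r] - 1). The alternating sum over all r vanishes, since
   evens and odds each sum to 0. *)
have lucas_sum : \sum_(r < p) (lucas_poly p r).[1] / r%:R ^+ 2 = 3%:R * (a - b).
  pose f r := (lucas_poly p r).[1] * h r.
  have -> : \sum_(r < p) (lucas_poly p r).[1] / r%:R ^+ 2 = \sum_(r < p.+1) f r.
    by rewrite big_ord_recr /= /f pchar_Fp_0 // expr0n invr0 mulr0 addr0.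
  have fE r : f r = (if (3 %| r)%N then 3%:R * ((-1) ^+ r * h r) else 0) - (-1) ^+ r * h r.
    by rewrite /f lucas_poly_at1; case: ifP => _; ring.
  under eq_bigr => r _ do rewrite fE.
  have sgn (P : pred nat) : \sum_(r < p.+1 | P r) (-1) ^+ r * h r =
      sum_inv2 [pred r | P r && (2 %| r)%N] - sum_inv2 [pred r | P r && ~~ (2 %| r)%N].
    rewrite (bigID (fun r : 'I_p.+1 => 2 %| r)%N) /= -sumrN; congr (_ + _).
      by apply: eq_bigr => r /andP[_]; rewrite dvdn2 -signr_odd => /negPf ->; rewrite mul1r.
    by apply: eq_bigr => r /andP[_]; rewrite dvdn2 negbK -signr_odd => ->; rewrite mulN1r.
  rewrite big_split sumrN /= -big_mkcond -mulr_sumr (sgn (dvdn 3)) (sgn predT) b_rev /=.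
  have := sum_inv2_split predT (dvdn 2); rewrite sum_inv2_all.
  rewrite [X in X + _](_ : _ = 0) ?add0r => [<-|]; first by rewrite -even0 subrr subr0.
  by rewrite -even0.
rewrite sum_central_lucas // lucas_sum nine.
(* With c = 4b and a = -5b, both 6(a - b) and 9(a + b) are -36b. *)
have -> : a = - (b + c) by rewrite -[LHS]addr0 -[0 in LHS]oppr0 -abc; ring.
by rewrite cb; ring.
Qed.

End InverseSquares.

(** * Bernoulli polynomials *)

Lemma size_bernl n : size (bernl n) = n.+1.
Proof. by elim: n => //= n IHn; rewrite size_rcons IHn. Qed.

Lemma nth_bernl n k : (k <= n)%N -> nth 0 (bernl n) k = bernoulli k.
Proof.
elim: n => [|n IHn]; first by rewrite leqn0 => /eqP ->.
rewrite leq_eqVlt => /predU1P[-> //|]; rewrite ltnS => lekn.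
by rewrite [bernl _]/= nth_rcons size_bernl ltnS lekn IHn.
Qed.

Lemma bernoulliS n :
  bernoulli n.+1 = - (n.+2%:R)^-1 * \sum_(k < n.+1) 'C(n.+2, k)%:R * bernoulli k.
Proof.
rewrite {1}/bernoulli [bernl _]/= nth_rcons size_bernl ltnn eqxx; congr (_ * _).
by apply: eq_bigr => k _; rewrite nth_bernl // -ltnS.
Qed.

Lemma sum_bin_bernoulli n : \sum_(k < n.+2) 'C(n.+2, k)%:R * bernoulli k = 0.
Proof.
rewrite big_ord_recr /= bernoulliS binSn mulrA mulrN divff ?pnatr_eq0 //.
by rewrite mulN1r subrr.
Qed.

Definition Bernpoly n : {poly rat} :=
  \sum_(k < n.+1) ('C(n, k)%:R * bernoulli k) *: 'X^(n - k).

Lemma horner_Bernpoly n x : (Bernpoly n).[x] = bernpoly n x.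
Proof. by rewrite horner_sum; apply: eq_bigr => k _; rewrite hornerZ hornerXn. Qed.

Lemma deriv_Bernpoly n : (Bernpoly n.+1)^`() = n.+1%:R *: Bernpoly n.
Proof.
rewrite linear_sum big_ord_recr /= subnn derivZ derivC scaler0 addr0 scaler_sumr.
apply: eq_bigr => k _; have lekn : (k <= n)%N by rewrite -ltnS.
rewrite derivZ derivXn subSn //= -scaler_nat !scalerA mulrA -subSn // mulrAC -!natrM.
by rewrite mul_bin_down mulnC.
Qed.

Lemma poly_deriv0 (P : {poly rat}) : P^`() = 0 -> P = (P.[0])%:P.
Proof.
move=> dP0; apply/polyP => -[|i]; rewrite coefC horner_coef0 //=.
move/(congr1 (fun Q : {poly rat} => Q`_i)): dP0; rewrite coef_deriv coef0 => /eqP.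
by rewrite mulrn_eq0 /= => /eqP.
Qed.

Lemma bernpoly0 n : bernpoly n 0 = bernoulli n.
Proof.
rewrite /bernpoly big_ord_recr /= subnn expr0 mulr1 binn mul1r big1 ?add0r // => k _.
by rewrite expr0n subn_eq0 leqNgt ltn_ord mulr0.
Qed.

Lemma bernpoly1 n : bernpoly n 1 = bernoulli n + (n == 1)%:R.
Proof.
rewrite /bernpoly; under eq_bigr => k _ do rewrite expr1n mulr1.
rewrite big_ord_recr /= binn mul1r addrC; congr (_ + _).
by case: n => [|[|n]]; rewrite ?big_ord0 ?sum_bin_bernoulli ?big_ord1 ?bin0 ?mul1r.
Qed.

(** Induction by differentiation; the constant of integration comes from B_n(1) - B_n(0), which is 1
    for n = 1 and 0 otherwise. *)
Lemma Bernpoly_diff n : (Bernpoly n.+1 \Po ('X + 1)) - Bernpoly n.+1 = n.+1%:R *: 'X^n.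
Proof.
have diff0 m : ((Bernpoly m \Po ('X + 1)) - Bernpoly m).[0] = (m == 1)%:R.
  rewrite hornerD hornerN horner_comp hornerD hornerX hornerC add0r !horner_Bernpoly.
  by rewrite bernpoly0 bernpoly1 addrAC subrr add0r.
elim: n => [|n IHn]; apply/eqP; rewrite -subr_eq0; apply/eqP; rewrite [LHS]poly_deriv0.
- by rewrite hornerD diff0 hornerN hornerZ hornerXn mulr1 subrr.
- have -> : Bernpoly 1 = 'X + (bernoulli 1)%:P.
    by rewrite /Bernpoly big_ord_recl big_ord1 /= mul1r scale1r expr1 mul1r expr0 alg_polyC.
  rewrite comp_polyD comp_polyX comp_polyC scale1r expr0.
  by have -> : forall c : {poly rat}, 'X + 1 + c - ('X + c) - 1 = 0; [move=> c; ring|rewrite deriv0].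
- by rewrite hornerD diff0 hornerN hornerZ hornerXn expr0n mulr0 subrr.
rewrite !derivB deriv_comp !deriv_Bernpoly derivZ derivXn derivD derivX derivC addr0 mulr1.
by rewrite comp_polyZ -scalerBr IHn /= -scaler_nat subrr.
Qed.

Lemma sum_powers n M :
  n.+1%:R * \sum_(s < M) (s%:R : rat) ^+ n = bernpoly n.+1 M%:R - bernoulli n.+1.
Proof.
elim: M => [|M IHM]; first by rewrite big_ord0 mulr0 bernpoly0 subrr.
rewrite big_ord_recr /= mulrDr IHM.
have := congr1 (fun P : {poly rat} => P.[M%:R]) (Bernpoly_diff n).
rewrite hornerD hornerN horner_comp hornerD hornerX hornerC hornerZ hornerXn natr1.
by rewrite !horner_Bernpoly => <-; ring.
Qed.

(* If D n := B_n(1-X) - (-1)^n B_n vanishes, then D n.+1 is a constant d and D n.+2 is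
   affine of slope - n.+2 d; but D n.+2 takes the same value at 0 and 1, so d = 0. *)
Lemma Bernpoly_reflect n : Bernpoly n \Po (1 - 'X) = (- 1) ^+ n *: Bernpoly n.
Proof.
pose D n := (Bernpoly n \Po (1 - 'X)) - (- 1) ^+ n *: Bernpoly n.
have dD m : (D m.+1)^`() = - (m.+1%:R *: D m).
  rewrite derivB derivZ deriv_comp !deriv_Bernpoly comp_polyZ derivB derivC derivX exprS.
  by rewrite /D -!mul_polyC !rmorphM /= rmorphN1; ring.
suff : D n = 0 by move/eqP; rewrite subr_eq0 => /eqP.
elim: n => [|n IHn].
  have B0 : Bernpoly 0 = 1 by rewrite /Bernpoly big_ord1 bin0 mul1r scale1r.
  by rewrite /D B0 rmorph1 expr0 scale1r subrr.
have D1 : D n.+1 = (D n.+1).[0]%:P by apply: poly_deriv0; rewrite dD IHn scaler0 oppr0.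
set d := (D n.+1).[0] in D1; rewrite D1.
have D2 : D n.+2 + (n.+2%:R * d) *: 'X = (D n.+2).[0]%:P.
  rewrite [LHS]poly_deriv0; first by rewrite !hornerE.
  by rewrite derivD dD D1 derivZ derivX alg_polyC -mul_polyC -polyCM addNr.
have D_ends : (D n.+2).[1] = (D n.+2).[0].
  rewrite /D !hornerE !horner_comp !hornerE subrr.
  by rewrite !horner_Bernpoly !bernpoly0 !bernpoly1 addr0.
move/(congr1 (fun P : {poly rat} => P.[1])): D2.
rewrite hornerD hornerZ hornerX mulr1 hornerC D_ends => /eqP.
by rewrite -subr_eq0 addrAC subrr add0r mulf_eq0 pnatr_eq0 => /eqP ->.
Qed.

Lemma bernpoly_reflect n x : bernpoly n (1 - x) = (- 1) ^+ n * bernpoly n x.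
Proof.
have := congr1 (fun P : {poly rat} => P.[x]) (Bernpoly_reflect n).
by rewrite horner_comp !hornerE !horner_Bernpoly.
Qed.

Lemma bernoulli_odd n : odd n -> (1 < n)%N -> bernoulli n = 0.
Proof.
move=> odd_n n_gt1; have := bernpoly_reflect n 0.
rewrite subr0 bernpoly0 bernpoly1 gtn_eqF // addr0 -signr_odd odd_n mulN1r => /eqP.
by rewrite -addr_eq0 -mulr2n mulrn_eq0 /= => /eqP.
Qed.

(** * Reduction of p-integral rationals *)

(* x is p-integral and reduces to a mod p *)
Definition red p (x : rat) (a : 'F_p) : Prop :=
  exists u : int, exists v : nat,
    [/\ ~~ (p %| v)%N, x = u%:~R / v%:R & a = u%:~R / v%:R].

Section Reduction.
Variables (p : nat).
Hypothesis (pr_p : prime p).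

Lemma rat_natr_neq0 v : ~~ (p %| v)%N -> v%:R != 0 :> rat.
Proof. by rewrite pnatr_eq0; apply: contraNneq => ->; rewrite dvdn0. Qed.

Lemma red_int (z : int) : red z%:~R (z%:~R : 'F_p).
Proof. by exists z, 1%N; rewrite !divr1 dvdn1 gtn_eqF ?prime_gt1. Qed.

Lemma red_nat n : red n%:R (n%:R : 'F_p).
Proof. exact: (red_int n%:Z). Qed.

Lemma redV n : ~~ (p %| n)%N -> red n%:R^-1 (n%:R^-1 : 'F_p).
Proof. by move=> ndvd; exists 1, n; rewrite !div1r. Qed.

Lemma redD x y (a b : 'F_p) : red x a -> red y b -> red (x + y) (a + b).
Proof.
move=> [u [v [ndv -> ->]]] [u' [v' [ndv' -> ->]]].
exists (u * v'%:R + u' * v%:R), (v * v')%N.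
split; first by rewrite Euclid_dvdM // negb_or ndv.
  by rewrite addf_div ?rat_natr_neq0 // natrM rmorphD !rmorphM /= !rmorph_nat.
by rewrite addf_div ?natFp_eq0 // natrM rmorphD !rmorphM /= !rmorph_nat.
Qed.

Lemma redM x y (a b : 'F_p) : red x a -> red y b -> red (x * y) (a * b).
Proof.
move=> [u [v [ndv -> ->]]] [u' [v' [ndv' -> ->]]].
exists (u * u'), (v * v')%N.
split; first by rewrite Euclid_dvdM // negb_or ndv.
  by rewrite mulf_div natrM rmorphM.
by rewrite mulf_div natrM rmorphM.
Qed.

Lemma redN x (a : 'F_p) : red x a -> red (- x) (- a).
Proof. by move=> /(redM (red_int (- 1))); rewrite !rmorphN1 !mulN1r. Qed.

Lemma redX x (a : 'F_p) n : red x a -> red (x ^+ n) (a ^+ n).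
Proof.
move=> redx; elim: n => [|n IHn]; first exact: (red_nat 1).
by rewrite !exprS; apply: redM.
Qed.

Lemma red_sum n (x : nat -> rat) (a : nat -> 'F_p) :
  (forall k, (k < n)%N -> red (x k) (a k)) -> red (\sum_(k < n) x k) (\sum_(k < n) a k).
Proof.
move=> redxa; apply: (big_ind2 (fun y b => red y b)); first exact: (red_nat 0).
  by move=> *; apply: redD.
by move=> k _; apply: redxa.
Qed.

Lemma red_uniq x (a b : 'F_p) : red x a -> red x b -> a = b.
Proof.
move=> [u [v [ndv -> ->]]] [u' [v' [ndv' /eqP + ->]]].
rewrite eqr_div ?rat_natr_neq0 // [v%:R]pmulrn [v'%:R]pmulrn -!intrM eqr_int => /eqP uv.
by apply/eqP; rewrite eqr_div ?natFp_eq0 // [v%:R]pmulrn [v'%:R]pmulrn -!intrM uv.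
Qed.

(** The bridge to [rat_congr]: after division by p^2, a congruence mod p^3 becomes a reduction equal
    to 0. *)
Lemma red0_divp x : red x (0 : 'F_p) -> ~~ (p%:Z %| denq (x / p%:R))%Z.
Proof.
move=> [u [v [ndv -> /esym/eqP]]].
rewrite mulf_eq0 invr_eq0 natFp_eq0 // (negPf ndv) orbF intFp_eq0 // => /dvdzP[w ->].
have p0 : p%:R != 0 :> rat by rewrite pnatr_eq0 -lt0n prime_gt0.
have -> : (w * p)%:~R / v%:R / p%:R = w%:~R / v%:R :> rat.
  by rewrite rmorphM /= mulrAC mulfK.
set y := w%:~R / v%:R; have /eqP : (numq y)%:~R / (denq y)%:~R = w%:~R / (v%:Z)%:~R :> rat.
  by rewrite divq_num_den.
rewrite eqr_div ?intr_eq0 ?denq_eq0 //; last by have := rat_natr_neq0 ndv; rewrite pnatr_eq0.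
rewrite -!rmorphM /= eqr_int => /eqP eq_nd; apply: contra ndv => dvd_den.
have : (denq y %| numq y * v)%Z by rewrite eq_nd dvdz_mull.
rewrite Gauss_dvdzr; first by move/(dvdz_trans dvd_den).
by rewrite coprimez_sym; exact: coprime_num_den.
Qed.

(** The recurrence for B_k divides only by k + 1, which stays below p for k <= p - 2. *)
Lemma red_bernoulli k : (k <= p - 2)%N -> exists b : 'F_p, red (bernoulli k) b.
Proof.
elim/ltn_ind: k => -[_ _|k IHk lekp]; first by exists 1; exact: (red_nat 1).
suff [c redc] : exists c : 'F_p, red (\sum_(i < k.+1) 'C(k.+2, i)%:R * bernoulli i) c.
  exists (- k.+2%:R^-1 * c); rewrite bernoulliS; apply: redM => //; apply/redN/redV.
  by rewrite gtnNdvd //; lia.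
apply: (big_ind (fun x => exists c : 'F_p, red x c)); first by exists 0; exact: (red_nat 0).
  by move=> x y [c redc] [d redd]; exists (c + d); apply: redD.
move=> i _; have [|b redb] := IHk i (ltn_ord i); first by have := ltn_ord i; lia.
by exists ('C(k.+2, i)%:R * b); apply: redM => //; apply: red_nat.
Qed.

(** The coefficients are p-integral, so the value mod p depends only on the argument mod p; this
    lets an integer stand in for 1/3. *)
Lemma red_bernpoly m x y (a : 'F_p) : (m <= p - 2)%N -> red x a -> red y a ->
  exists c : 'F_p, red (bernpoly m x) c /\ red (bernpoly m y) c.
Proof.
move=> lemp redx redy; rewrite /bernpoly.
apply: (big_ind2 (fun x y => exists c : 'F_p, red x c /\ red y c)).
- by exists 0; split; exact: (red_nat 0).
- move=> x1 x2 y1 y2 [c [redc redc']] [d [redd redd']]; exists (c + d).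
  by split; apply: redD.
move=> k _; have [|b redb] := @red_bernoulli k; first by have := ltn_ord k; lia.
exists ('C(m, k)%:R * b * a ^+ (m - k)).
by split; (apply: redM; [apply: redM => //; apply: red_nat|apply: redX]).
Qed.

Hypothesis p_ge5 : (5 <= p)%N.

(** With M = floor(p/3) + 1, 3M is 3 - (p mod 3) mod p, so M is 2/3 if p = 1 mod 3 and 1/3 if p = 2
    mod 3. Reflection in the first case supplies the sign that matches the Legendre symbol. *)
Lemma red_bernpoly_third : red (legendre3 p * bernpoly (p - 2) (3%:R^-1))
  (2%:R * \sum_(s < (p %/ 3).+1) s%:R ^- 2 : 'F_p).
Proof.
have odd_p := odd_prime_ge5 pr_p p_ge5.
set H := \sum_(s < _) _; set M := (p %/ 3).+1 in H *.
have redM2H : red (bernpoly (p - 2) M%:R) (- (2%:R * H)).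
  have := sum_powers (p - 3) M; have -> : (p - 3).+1 = (p - 2)%N by lia.
  rewrite bernoulli_odd ?subr0; [move=> <-| by rewrite oddB ?odd_p //; lia | by lia].
  have -> : - (2%:R * H) = (p - 2)%:R * \sum_(s < M) s%:R ^+ (p - 3) :> 'F_p.
    rewrite natrB ?(leq_trans _ p_ge5) // pchar_Fp_0 // sub0r mulNr; congr (- (_ * _)).
    (* At s = 0 both sides are 0, as p > 3 and 0^-1 = 0; elsewhere Fermat applies. *)
    apply: eq_bigr => s _; have [s0|s0] := eqVneq (s%:R : 'F_p) 0.
      by rewrite s0 !expr0n invr0 gtn_eqF //; lia.
    apply: (mulfI (expf_neq0 2 s0)); rewrite mulfV ?expf_neq0 // -exprD.
    by rewrite (_ : 2 + (p - 3) = p.-1)%N ?Fp_expn_pred //; lia.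
  apply: redM; first exact: red_nat.
  by apply: (red_sum (x := fun s => s%:R ^+ (p - 3)) (a := fun s => s%:R ^+ (p - 3))) => s _; apply/redX/red_nat.
have ndvd3 : ~~ (p %| 3)%N by rewrite gtnNdvd // (leq_trans _ p_ge5).
have three0 : 3%:R != 0 :> 'F_p by rewrite natFp_eq0.
have red3 := redV ndvd3.
have M3 : 3%:R * M%:R = (3 - p %% 3)%:R :> 'F_p.
  rewrite -natrM; have -> : (3 * M = p + (3 - p %% 3))%N by rewrite /M; lia.
  by rewrite natrD pchar_Fp_0 // add0r.
have p_mod3 : (p %% 3 != 0)%N.
  by rewrite -/(3 %| p)%N dvdn_prime2 //; apply: contraTneq p_ge5 => <-.
have transfer y : red y (M%:R : 'F_p) -> red (bernpoly (p - 2) y) (- (2%:R * H)).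
  move=> redy; have [c [redc redc']] := red_bernpoly (leqnn _) (red_nat M) redy.
  by rewrite -(red_uniq redc redM2H).
rewrite /legendre3; case: eqP => [p1|p1].
  rewrite mul1r -[X in red _ X]opprK -[X in red X _]opprK.
  have -> : - bernpoly (p - 2) 3%:R^-1 = bernpoly (p - 2) (1 - 3%:R^-1).
    by rewrite bernpoly_reflect -signr_odd oddB ?odd_p ?mulN1r //; lia.
  apply/redN/transfer.
  have -> : M%:R = 1 - 3%:R^-1 :> 'F_p.
    by apply: (mulfI three0); rewrite M3 p1 natrB // mulrBr mulfV // mulr1.
  by apply: redD; [exact: (red_nat 1) | apply: redN].
have p2 : (p %% 3 = 2)%N by move: p_mod3 p1; lia.
rewrite p2 /= mulN1r -[X in red _ X]opprK; apply/redN/transfer.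
have -> : M%:R = 3%:R^-1 :> 'F_p by apply: (mulfI three0); rewrite M3 p2 mulfV.
exact: red3.
Qed.

End Reduction.

(** * The congruence *)

Lemma bin_pred_prime_Fp p i : prime p -> (i < p)%N -> 'C(p.-1, i)%:R = (- 1) ^+ i :> 'F_p.
Proof.
move=> pr_p; elim: i => [|i IHi] ltip; first by rewrite bin0.
have /eqP : 'C(p, i.+1)%:R = 0 :> 'F_p by apply/eqP; rewrite natFp_eq0 // prime_dvd_bin.
have -> : 'C(p, i.+1) = ('C(p.-1, i.+1) + 'C(p.-1, i))%N by rewrite -binS prednK ?prime_gt0.
rewrite natrD IHi; last exact: ltnW.
by rewrite addr_eq0 exprS mulN1r => /eqP.
Qed.

(** If 2r >= p, doubling carries: the last base-p digit 2r - p is less than r, and both sides vanish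
    by Lucas. *)
Lemma bin_central_lucas p j r : prime p -> odd p -> (r < p)%N ->
  'C((j * p + r).*2, j * p + r)%:R = 'C(j.*2, j)%:R * 'C(r.*2, r)%:R :> 'F_p.
Proof.
move=> pr_p odd_p ltrp; have [lt2r|le2r] := ltnP r.*2 p.
  by rewrite doubleD doubleMl lucas_Fp.
pose s := (r.*2 - p)%N; have lt_sr : (s < r)%N by rewrite /s; lia.
have ltsp : (s < p)%N by apply: ltn_trans ltrp.
have bin_eq0 a b : 'C(a * p + s, b * p + r)%:R = 0 :> 'F_p.
  by rewrite lucas_Fp // (bin_small lt_sr) mulr0.
have -> : ((j * p + r).*2 = j.*2.+1 * p + s)%N by rewrite /s; nia.
have -> : 'C(r.*2, r) = 'C(1 * p + s, 0 * p + r) by congr 'C(_, _); rewrite /s; lia.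
by rewrite !bin_eq0 mulr0.
Qed.

Lemma sum_blocks (V : nmodType) (f : nat -> V) n p :
  \sum_(k < n * p) f k = \sum_(j < n) \sum_(r < p) f (j * p + r)%N.
Proof.
elim: n => [|n IHn]; first by rewrite !big_ord0.
by rewrite mulSnr big_split_ord /= IHn [RHS]big_ord_recr.
Qed.

Section Assembly.
Variables (p n : nat).
Hypotheses (pr_p : prime p) (p_ge5 : (5 <= p)%N).

Let odd_p : odd p := odd_prime_ge5 pr_p p_ge5.

Definition bin_quot j r := ('C(n * p, j * p + r) %/ p)%N.

Lemma bin_quot_mul j r : (0 < r < p)%N -> ('C(n * p, j * p + r) = p * bin_quot j r)%N.
Proof.
move=> /andP[r_gt0 ltrp]; rewrite /bin_quot [RHS]mulnC divnK //.
have /prednK kE : (0 < j * p + r)%N by rewrite addn_gt0 r_gt0 orbT.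
have := mul_bin_diag (n * p) (j * p + r).-1; rewrite kE => eq_bin.
have : (p %| (j * p + r) * 'C(n * p, j * p + r))%N.
  by rewrite -eq_bin -mulnA mulnCA dvdn_mulr.
by rewrite Gauss_dvdr // prime_coprime // dvdn_addr ?dvdn_mull // gtnNdvd.
Qed.

(** Absorption gives (jp + r) q = n binom(np-1, jp+r-1) for the quotient q; Lucas evaluates the
    right side mod p, and squaring removes the sign (-1)^(r-1). *)
Lemma bin_quot_sqr j r : (j < n)%N -> (0 < r < p)%N ->
  (bin_quot j r)%:R ^+ 2 = ('C(n, j) ^ 2 * (n - j) ^ 2)%:R / r%:R ^+ 2 :> 'F_p.
Proof.
move=> ltjn bnd_r; have /andP[r_gt0 ltrp] := bnd_r.
have r0 : r%:R != 0 :> 'F_p by rewrite natFp_neq0.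
have p_gt0 := prime_gt0 pr_p; have n_gt0 : (0 < n)%N by apply: leq_ltn_trans ltjn.
have eq_quot : (n * 'C(n.-1 * p + p.-1, j * p + r.-1) = (j * p + r) * bin_quot j r)%N.
  have := mul_bin_diag (n * p) (j * p + r.-1).
  have -> : ((n * p).-1 = n.-1 * p + p.-1)%N by nia.
  rewrite -addnS prednK // bin_quot_mul // => eq_bin.
  by apply/eqP; rewrite -(eqn_pmul2l p_gt0) mulnA [(p * n)%N]mulnC eq_bin mulnCA.
have : r%:R * (bin_quot j r)%:R = ('C(n, j) * (n - j))%:R * (- 1) ^+ r.-1 :> 'F_p.
  have ltr1p : (r.-1 < p)%N := leq_ltn_trans (leq_pred r) ltrp.
  rewrite [('C(n, j) * _)%N]mulnC -mul_bin_down -bin_pred_prime_Fp // natrM -mulrA.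
  rewrite -lucas_Fp //; last by rewrite prednK.
  have := congr1 (fun m => m%:R : 'F_p) eq_quot.
  by rewrite !natrM natrD natrM pchar_Fp_0 // mulr0 add0r.
move/(congr1 (fun x => x ^+ 2)); rewrite !exprMn exprAC sqrrN !expr1n mulr1.
by rewrite -expnMn natrX => <-; rewrite mulrC mulKf ?expf_neq0.
Qed.

Definition Cstar_quot : nat :=
  \sum_(j < n) \sum_(r < p | (0 < r)%N) bin_quot j r ^ 2 * 'C((j * p + r).*2, j * p + r).

Lemma Cstar_quot_Fp : Cstar_quot%:R =
  (\sum_(j < n) 'C(n, j) ^ 2 * 'C(j.*2, j) * (n - j) ^ 2)%N%:R *
  \sum_(r < p) 'C(r.*2, r)%:R / r%:R ^+ 2 :> 'F_p.
Proof.
rewrite /Cstar_quot !natr_sum mulr_suml; apply: eq_bigr => j _.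
rewrite natr_sum [in RHS](bigID (fun r : 'I_p => 0 < r)%N) /= [X in _ + X]big1 ?addr0; last first.
  by move=> r; rewrite lt0n negbK => /eqP ->; rewrite expr0n invr0 mulr0.
rewrite mulr_sumr; apply: eq_bigr => r r_gt0.
rewrite natrM natrX bin_quot_sqr ?r_gt0 ?ltn_ord // bin_central_lucas //.
by rewrite !natrM; ring.
Qed.

Lemma Cstar_decomp : exists z : int,
  (Cstar (n * p))%:R = (Cstar n)%:R + z%:~R * p%:R ^+ 3 + p%:R ^+ 2 * Cstar_quot%:R :> rat.
Proof.
pose g k := ('C(n * p, k) ^ 2 * 'C(k.*2, k))%N.
have gE j r : (0 < r < p)%N ->
    g (j * p + r)%N = (p ^ 2 * (bin_quot j r ^ 2 * 'C((j * p + r).*2, j * p + r)))%N.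
  by move=> bnd_r; rewrite /g bin_quot_mul // expnMn mulnA.
pose A := (\sum_(j < n.+1) g (j * p)%N)%N.
have CE : Cstar (n * p) = (A + p ^ 2 * Cstar_quot)%N.
  (* The last index k = np lies outside the n blocks of length p; it provides the term j = n of
     [A]. *)
  rewrite /Cstar big_ord_recr /= -/(g (n * p)%N) (sum_blocks g) /A big_ord_recr /=.
  rewrite addnAC; congr (_ + _)%N; rewrite /Cstar_quot big_distrr -big_split /=.
  apply: eq_bigr => j _; rewrite (bigD1 (Ordinal (prime_gt0 pr_p))) //= addn0; congr (_ + _)%N.
  rewrite big_distrr; apply: eq_big => [r|r]; first by rewrite -val_eqE lt0n.
  by move=> r_neq0; rewrite gE // ltn_ord andbT lt0n.
have p3_gt1 : (1 < p ^ 3)%N by rewrite (ltn_exp2l 0) ?prime_gt1.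
have jac a b : (b <= a)%N -> 'C(p * a, p * b)%:R = 'C(a, b)%:R :> 'Z_(p ^ 3).
  by move=> leba; apply: val_inj; rewrite /= !val_Zp_nat // jacobsthal.
have A_mod : A = Cstar n %[mod p ^ 3].
  apply: Zp_nat_inj => //; rewrite !natr_sum; apply: eq_bigr => j _.
  rewrite /g doubleMl !(mulnC _ p) natrM natrX !jac -?natrX -?natrM //.
    by rewrite -addnn leq_addr.
  by rewrite -ltnS.
have /eqP : (A = Cstar n %[mod (p ^ 3)%N])%Z by rewrite !modz_nat A_mod.
rewrite eqz_mod_dvd => /dvdzP[z Az]; exists z.
move/(congr1 (intr : int -> rat)): Az; rewrite rmorphB rmorphM /= -!pmulrn natrX => Az.
by rewrite CE natrD natrM natrX -Az addrC [in RHS]addrC subrKC.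
Qed.

End Assembly.

Theorem theorem2p2 (p n : nat) :
  prime p -> (5 <= p)%N -> (0 < n)%N ->
  rat_congr (Cstar (n * p))%:R
    ((Cstar n)%:R + (p ^ 2)%:R * legendre3 p * bernpoly (p - 2) (3%:R^-1) * Cscr n)
    p 3.
Proof.
move=> pr_p p_ge5 _; rewrite /rat_congr.
have [z ->] := Cstar_decomp n pr_p p_ge5.
set W := Cstar_quot p n; set L := legendre3 p; set B := bernpoly _ _; set c := (Cstar n)%:R.
have p0 : p%:R != 0 :> rat by rewrite pnatr_eq0 -lt0n prime_gt0.
have -> : (c + z%:~R * p%:R ^+ 3 + p%:R ^+ 2 * W%:R - (c + (p ^ 2)%:R * L * B * Cscr n)) / (p ^ 3)%:R
    = (z%:~R * p%:R + W%:R - L * B * Cscr n) / p%:R.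
  by rewrite !natrX; field.
apply: red0_divp => //.
set Q := (\sum_(j < n) 'C(n, j) ^ 2 * 'C(j.*2, j) * (n - j) ^ 2)%N.
have redC : red (Cscr n) (2%:R^-1 * Q%:R : 'F_p).
  apply: redM => //; first by apply: redV => //; rewrite gtnNdvd // (leq_trans _ p_ge5).
  by rewrite -natr_sum; apply: red_nat.
have := redM pr_p (red_bernpoly_third pr_p p_ge5) redC.
rewrite -(sum_central_harmonic pr_p p_ge5) => /(redN pr_p).
move/(redD pr_p (redD pr_p (redM pr_p (red_int pr_p z) (red_nat pr_p p)) (red_nat pr_p W))).
rewrite pchar_Fp_0 // mulr0 add0r Cstar_quot_Fp // -/Q.
(* The factor 2 from the Bernoulli value cancels the 1/2 in [Cscr]. *)
set S := \sum_(r < p) _; have -> // : Q%:R * S - 2%:R * S * (2%:R^-1 * Q%:R) = 0 :> 'F_p.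
by have := two_neq0 pr_p p_ge5 => two0; field.
Qed.
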